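(* The marginal score-matching objective $$\mathcal{L}_{\mathrm{SM}}(\theta):=\frac12\int_0^1\lambda(t)\,\mathbb{E}_{X_t\sim p_t}\bigl[\|s_\theta(X_t,t)-\nabla\log p_t(X_t)\|_2^2\bigr]\mathrm{d}t$$ and the conditional score-matching objective $$\mathcal{L}_{\mathrm{CSM}}(\theta):=\frac12\int_0^1\lambda(t)\,\mathbb{E}_{X_1,\;X_t\sim p_t(\cdot\mid X_1)}\bigl[\|s_\theta(X_t,t)-\nabla\log p_t(X_t\mid X_1)\|_2^2\bigr]\mathrm{d}t$$ differ only by a constant independent of $\theta$. Equivalently, $$\mathcal{L}_{\mathrm{CSM}}(\theta)=\mathcal{L}_{\mathrm{SM}}(\theta)+C.$$
   Context: Generative-time convention: $t$ runs from $0$ (noise) to $1$ (data), and $X_1\sim p_1$ is a data sample in $\mathbb{R}^d$ with density $p_1$. The schedules $\alpha_t,\sigma_t$ satisfy $\alpha_0=0$, $\alpha_1=1$, $\sigma_0=1$, $\sigma_1=0$, $\alpha_t\ge0$ and $\sigma_t\ge0$ for all $t\in[0,1]$, and $-\frac{\mathrm{d}}{\mathrm{d}t}\sigma_t^2+2\frac{\dot\alpha_t}{\alpha_t}\sigma_t^2\ge0$; a dot denotes $\mathrm{d}/\mathrm{d}t$. Conditional path: $p_t(x\mid x_1):=\mathcal{N}(x;\alpha_tx_1,\sigma_t^2I)$ (Gaussian density with mean $\alpha_tx_1$ and covariance $\sigma_t^2I$), the law of $X_t$ given $X_1=x_1$; marginal path: $p_t(x):=\int_{\mathbb{R}^d}p_t(x\mid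 x_1)p_1(x_1)\,\mathrm{d}x_1$. Gradients are with respect to $x$. $s_\theta(x,t)\in\mathbb{R}^d$ is a score model with parameter $\theta$, and $\lambda(t)\ge0$ is a user-chosen weighting function. *)

(* Defs.v *)
From HB Require Import structures.
From mathcomp Require Import all_boot all_order all_algebra.
From mathcomp Require Import all_classical all_reals all_analysis.
Set Implicit Arguments.
Unset Strict Implicit.
Unset Printing Implicit Defensive.
Import Order.TTheory GRing.Theory Num.Theory.
Import numFieldNormedType.Exports.
Local Open Scope classical_set_scope.
Local Open Scope ring_scope.

(* R^d is 'rV[R]_d with the product sigma-algebra, i.e. the one generated by
   the coordinate maps. *)
Definition rV_display (R : realType) (d : nat) : measure_display.
Proof. by []. Qed.

Section rV_measurable.
Context {R : realType} {d : nat}.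

Definition rV_coord (i : 'I_d) (v : 'rV[R]_d) : R := v 0 i.

Let rV_set0 : g_sigma_preimage rV_coord set0.
Proof. exact: sigma_algebra0. Qed.

Let rV_setC A : g_sigma_preimage rV_coord A -> g_sigma_preimage rV_coord (~` A).
Proof. exact: sigma_algebraC. Qed.

Let rV_bigcup (F : _^nat) : (forall i, g_sigma_preimage rV_coord (F i)) ->
  g_sigma_preimage rV_coord (\bigcup_i (F i)).
Proof. exact: sigma_algebra_bigcup. Qed.

HB.instance Definition _ := @isMeasurable.Build (rV_display R d)
  'rV[R]_d (g_sigma_preimage rV_coord) rV_set0 rV_setC rV_bigcup.

Lemma measurable_rV_coord (i : 'I_d) : measurable_fun [set: 'rV[R]_d] (rV_coord i).
Proof.
move=> _ Y mY; rewrite setTI; apply: sub_sigma_algebra => /=.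
rewrite -bigcup_seq/=; exists i => /=; first by rewrite mem_index_enum.
by exists Y => //; rewrite setTI.
Qed.

Lemma measurable_fun_rV d1 (T : measurableType d1) (f : T -> 'rV[R]_d) :
  (forall i, measurable_fun [set: T] (rV_coord i \o f)) ->
  measurable_fun [set: T] f.
Proof.
move=> mf.
suff : g_sigma_preimage (fun i => rV_coord i \o f) `<=` measurable.
  by rewrite g_sigma_preimage_comp => prefS _ A mA; apply: prefS; exists A.
apply: smallest_sub; first exact: sigma_algebra_measurable.
rewrite -bigcup_seq; apply: bigcup_sub => i _.
by move=> A [B mB <-]; exact: mf.
Qed.

End rV_measurable.

Section lebesgue_rV.
Context {R : realType}.

Definition rV_cons n (p : measurableTypeR R * 'rV[R]_n) : 'rV[R]_n.+1 :=
  row_mx (const_mx p.1 : 'rV[R]_1) p.2.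

Lemma rV_cons0 n p : @rV_cons n p 0 0 = p.1.
Proof.
have -> : 0 = lshift n (0 : 'I_1) :> 'I_n.+1 by exact: val_inj.
by rewrite /rV_cons (row_mxEl (const_mx _ : 'rV_1)) mxE.
Qed.

Lemma rV_cons_lift n p i : @rV_cons n p 0 (lift 0 i) = p.2 0 i.
Proof.
have -> : lift 0 i = rshift 1 i :> 'I_(1 + n) by exact: val_inj.
by rewrite /rV_cons (row_mxEr (const_mx _ : 'rV_1)).
Qed.

Lemma measurable_rV_cons n : measurable_fun setT (@rV_cons n).
Proof.
apply: measurable_fun_rV => i; case: (unliftP ord0 i) => [j ->|->].
  have -> : rV_coord (lift ord0 j) \o @rV_cons n = rV_coord j \o snd.
    by apply/funext => p; rewrite /= /rV_coord rV_cons_lift.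
  by apply: measurableT_comp => //; exact: measurable_rV_coord.
have -> : rV_coord ord0 \o @rV_cons n = fst.
  by apply/funext => p; rewrite /= /rV_coord rV_cons0.
exact: measurable_fst.
Qed.

Definition rV_uncons n (v : 'rV[R]_n.+1) : measurableTypeR R * 'rV[R]_n :=
  (v 0 0, \row_j v 0 (lift 0 j)).

Lemma rV_consK n : cancel (@rV_cons n) (@rV_uncons n).
Proof.
move=> [t v]; rewrite /rV_uncons rV_cons0/=; congr pair.
by apply/rowP => j; rewrite mxE rV_cons_lift.
Qed.

Lemma measurable_rV_uncons n : measurable_fun setT (@rV_uncons n).
Proof.
apply: measurable_fun_pair; first exact: (measurable_rV_coord (0 : 'I_n.+1)).
apply: measurable_fun_rV => j; have -> : rV_coord j \o
    (fun v : 'rV[R]_n.+1 => \row_j0 v 0 (lift 0 j0)) = rV_coord (lift 0 j).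
  by apply/funext => v; rewrite /= /rV_coord mxE.
exact: measurable_rV_coord.
Qed.

Section push.
Context n (mu : {sigma_finite_measure set 'rV[R]_n -> \bar R}).

Let nu := pushforward (lebesgue_measure \x mu)%E (@rV_cons n).

Let mcons A : measurable A -> measurable (@rV_cons n @^-1` A).
Proof. by move=> mA; rewrite -[X in measurable X]setTI; exact: measurable_rV_cons. Qed.

Let nu0 : nu set0 = 0%E.
Proof. by rewrite /nu /pushforward preimage_set0 measure0. Qed.

Let nu_ge0 A : (0 <= nu A)%E.
Proof. by rewrite /nu /pushforward measure_ge0. Qed.

Let nu_sigma_additive : semi_sigma_additive nu.
Proof.
move=> F mF tF mUF; rewrite /nu /pushforward preimage_bigcup.
apply: measure_semi_sigma_additive.
- by move=> k; exact: mcons.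
- apply/trivIsetP => /= i j _ _ ij; rewrite -preimage_setI.
  by move/trivIsetP : tF => /(_ _ _ _ _ ij) ->//; rewrite preimage_set0.
- by rewrite -preimage_bigcup; exact: mcons.
Qed.

HB.instance Definition _ := isMeasure.Build _ _ _ nu
  nu0 nu_ge0 nu_sigma_additive.

Let nu_sigma_finite : sigma_finite setT nu.
Proof.
have /sigma_finiteP[F [FT ndF Foo]] := sigma_finiteT (@lebesgue_measure R).
have /sigma_finiteP[G [GT ndG Goo]] := sigma_finiteT mu.
exists (fun k => @rV_uncons n @^-1` (F k `*` G k)).
  rewrite -preimage_bigcup; apply/esym/seteqP; split => // v _ /=.
  have [i _ Fi] : (\bigcup_i F i) (rV_uncons v).1 by rewrite -FT.
  have [j _ Gj] : (\bigcup_j G j) (rV_uncons v).2 by rewrite -GT.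
  exists (maxn i j) => //; split.
  - by apply: (subsetPset _ _ (ndF i _ _)) Fi; exact: leq_maxl.
  - by apply: (subsetPset _ _ (ndG j _ _)) Gj; exact: leq_maxr.
move=> k; have [mF Fk] := Foo k; have [mG Gk] := Goo k; split.
  rewrite -[X in measurable X]setTI; apply: measurable_rV_uncons => //.
  exact: measurableX.
rewrite /nu /pushforward -comp_preimage.
have -> : @rV_uncons n \o @rV_cons n = id.
  by apply/funext => p /=; rewrite rV_consK.
rewrite preimage_id product_measure1E// lte_mul_pinfty//.
by rewrite ge0_fin_numE.
Qed.

HB.instance Definition _ := Measure_isSigmaFinite.Build _ _ _ nu nu_sigma_finite.

Definition rV_push : {sigma_finite_measure set 'rV[R]_n.+1 -> \bar R} := nu.

End push.

(* Lebesgue measure on R^d, as the d-fold product of the one on R. *)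
Fixpoint lebesgue_rV (d : nat) : {sigma_finite_measure set 'rV[R]_d -> \bar R} :=
  match d with
  | 0 => \d_(0 : 'rV[R]_0)
  | n.+1 => rV_push (lebesgue_rV n)
  end.

Lemma lebesgue_rV_box d (A : 'I_d -> set R) : (forall i, measurable (A i)) ->
  lebesgue_rV d [set v | forall i, A i (v 0 i)] =
  (\prod_(i < d) lebesgue_measure (A i))%E.
Proof.
elim: d A => [A _|n IHn A mA] /=.
  by rewrite big_ord0 diracE mem_set//= => -[].
have mA' i : measurable (A (lift ord0 i)) by exact: mA.
set B := [set v : 'rV[R]_n | forall i, A (lift ord0 i) (v 0 i)].
have mB : measurable B.
  have -> : B = \bigcap_(i in [set: 'I_n]) (rV_coord i @^-1` A (lift ord0 i)).
    by apply/seteqP; split => v /= Av i => [_|]; exact: Av.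
  apply: fin_bigcap_measurable => // i _.
  by rewrite -[X in measurable X]setTI; exact: measurable_rV_coord.
rewrite big_ord_recl -(IHn _ mA') -/B -product_measure1E//; last exact: mA.
rewrite /rV_push/= /pushforward; congr (_ _).
apply/seteqP; split => [p /= Ap|p /= [A0 Ap] i].
  split => [|i]; first by have := Ap 0; rewrite rV_cons0.
  by have := Ap (lift ord0 i); rewrite rV_cons_lift.
by case: (unliftP ord0 i) => [j ->|->]; rewrite ?rV_cons_lift ?rV_cons0.
Qed.

End lebesgue_rV.

Section score_matching.
Context {R : realType} {d : nat}.
Local Notation V := 'rV[R]_d.
Local Notation leb := (@lebesgue_rV R d).

(* The library norm `|v| on 'rV[R]_d is the sup norm, hence this squared
   Euclidean norm. *)
Definition sqnorm2 (v : V) : R := \sum_(i < d) v 0 i ^+ 2.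

Definition grad (f : V -> R) (x : V) : V := \row_i 'D_(delta_mx 0 i) f x.

Definition score (p : V -> R) : V -> V := grad (fun y => ln (p y)).

Definition is_density (p : V -> R) : Prop :=
  [/\ measurable_fun [set: V] p, forall x, 0 <= p x
    & (\int[leb]_x (p x)%:E = 1)%E].

(* E_{X ~ p}[f X], for p a density and f valued in [0, +oo]. *)
Definition expect (p : V -> R) (f : V -> \bar R) : \bar R :=
  (\int[leb]_x (f x * (p x)%:E))%E.

(* Density of N(m, v I) for v > 0. There is no density when v = 0; the formula
   then gives 0 (for d > 0) because 0^-1 = 0. *)
Definition gauss_pdf (m : V) (v : R) (x : V) : R :=
  (Num.sqrt (2 * pi * v))^-1 ^+ d * expR (- (sqnorm2 (x - m) / (2 * v))).

(* The quotient alpha'/alpha (undefined at t = 0) restricts the last condition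
   to times where alpha is nonzero; derivatives are taken at interior times,
   and only alpha and sigma^2 are required to be differentiable, so that
   sigma = sqrt (1 - t) is allowed. *)
Definition schedule (alpha sigma : R -> R) : Prop :=
  [/\ [/\ alpha 0 = 0, alpha 1 = 1, sigma 0 = 1 & sigma 1 = 0],
      forall t, t \in `[0, 1] -> 0 <= alpha t /\ 0 <= sigma t,
      forall t, t \in `]0, 1[ -> derivable alpha t 1 /\
                                 derivable (fun u => sigma u ^+ 2) t 1
    & forall t, t \in `]0, 1[ -> alpha t != 0 ->
      0 <= - derive1 (fun u => sigma u ^+ 2) t
           + 2 * (derive1 alpha t / alpha t) * sigma t ^+ 2].

Definition cond_pdf (alpha sigma : R -> R) (t : R) (x1 x : V) : R :=
  gauss_pdf (alpha t *: x1) (sigma t ^+ 2) x.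

Definition marg_pdf (alpha sigma : R -> R) (p1 : V -> R) (t : R) (x : V) : R :=
  \int[leb]_x1 (cond_pdf alpha sigma t x1 x * p1 x1).

(* Both objectives are integrals of nonnegative functions, with values in
   [0, +oo]. *)
Definition SM_loss (lambda alpha sigma : R -> R) (p1 : V -> R)
    (s : V -> R -> V) : \bar R :=
  ((2^-1)%:E * \int[lebesgue_measure]_(t in `[0%R, 1%R])
    ((lambda t)%:E *
     expect (marg_pdf alpha sigma p1 t)
       (fun x => (sqnorm2 (s x t - score (marg_pdf alpha sigma p1 t) x))%:E)))%E.

Definition CSM_loss (lambda alpha sigma : R -> R) (p1 : V -> R)
    (s : V -> R -> V) : \bar R :=
  ((2^-1)%:E * \int[lebesgue_measure]_(t in `[0%R, 1%R])
    ((lambda t)%:E *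
     expect p1 (fun x1 => expect (cond_pdf alpha sigma t x1)
       (fun x => (sqnorm2 (s x t - score (cond_pdf alpha sigma t x1) x))%:E))))%E.

End score_matching.

(* Main.v *)
Require Import Defs.
From HB Require Import structures.
From mathcomp Require Import all_boot all_order all_algebra.
From mathcomp Require Import all_classical all_reals all_analysis.
From mathcomp Require Import measurable_realfun ring lra.
Import Order.TTheory GRing.Theory Num.Theory.
Import numFieldNormedType.Exports.
Local Open Scope classical_set_scope.
Local Open Scope ring_scope.

(* For fixed t and x, weight the data points x1 by w(x1) = p_t(x | x1) p1(x1).
   Differentiating under the integral sign, the marginal score at x is the
   w-average of the conditional scores - (x - alpha_t x1) / sigma_t^2, so the
   w-mean square of s - (conditional score) splits as the square of
   s - (marginal score) plus a w-variance that does not involve s. The Gaussian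
   factor makes the conditional score and its square w-integrable, whatever p1
   is. By Tonelli's theorem, C is half the lambda-weighted integral of these
   variances over t and x; no finiteness is needed, as all terms are
   nonnegative. Times with sigma_t = 0 contribute 0 to every integral. *)

Set Implicit Arguments.
Unset Strict Implicit.

(** * Mean-variance splitting of weighted mean squares *)

Section weighted_variance.
Context d (T : measurableType d) (R : realType).
Variable mu : {measure set T -> \bar R}.
Variable w : T -> R.
Hypothesis int_w : mu.-integrable setT (EFin \o w).

Section scalar.
Variable Y : T -> R.
Hypothesis int_Yw : mu.-integrable setT (EFin \o (fun y => Y y * w y)).
Hypothesis int_Y2w : mu.-integrable setT (EFin \o (fun y => Y y ^+ 2 * w y)).

Let sqr_dev u y : (u - Y y) ^+ 2 * w y =
  u ^+ 2 * w y - 2 * u * (Y y * w y) + Y y ^+ 2 * w y.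
Proof. ring. Qed.

Let int_uw u : mu.-integrable setT (EFin \o (fun y => u * w y)).
Proof. by have := integrableZl measurableT u int_w. Qed.

Let int_uYw u : mu.-integrable setT (EFin \o (fun y => u * (Y y * w y))).
Proof. by have := integrableZl measurableT u int_Yw. Qed.

Lemma integrable_sqr_dev u :
  mu.-integrable setT (EFin \o (fun y => (u - Y y) ^+ 2 * w y)).
Proof.
under eq_fun do rewrite sqr_dev.
have h := integrableD measurableT
  (integrableB measurableT (int_uw (u ^+ 2)) (int_uYw (2 * u))) int_Y2w.
by apply: eq_integrable h.
Qed.

Lemma Rintegral_sqr_dev u :
  \int[mu]_y ((u - Y y) ^+ 2 * w y) =
  u ^+ 2 * \int[mu]_y w y - 2 * u * \int[mu]_y (Y y * w y)
  + \int[mu]_y (Y y ^+ 2 * w y).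
Proof.
under eq_Rintegral do rewrite sqr_dev.
rewrite RintegralD//; last first.
  by have := integrableB measurableT (int_uw (u ^+ 2)) (int_uYw (2 * u));
    apply: eq_integrable.
by rewrite RintegralB// !RintegralZl.
Qed.

(** Once [m] is the [w]-mean of [Y], the cross term of [((u - m) + (m - Y))^2] integrates to 0. The
    mean is given by a product, not a quotient, because [w] is not normalised; its total mass stays
    as a factor. *)
Lemma Rintegral_sqr_dev_mean m u : m * \int[mu]_y w y = \int[mu]_y (Y y * w y) ->
  \int[mu]_y ((u - Y y) ^+ 2 * w y) =
  (u - m) ^+ 2 * \int[mu]_y w y + \int[mu]_y ((m - Y y) ^+ 2 * w y).
Proof. by move=> mE; rewrite !Rintegral_sqr_dev -mE; ring. Qed.

Lemma integral_sqr_dev_mean m u : m * \int[mu]_y w y = \int[mu]_y (Y y * w y) ->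
  (\int[mu]_y ((u - Y y) ^+ 2 * w y)%:E =
   ((u - m) ^+ 2 * \int[mu]_y w y)%:E + \int[mu]_y ((m - Y y) ^+ 2 * w y)%:E)%E.
Proof.
move=> mE; have intE v : (\int[mu]_y ((v - Y y) ^+ 2 * w y)%:E =
    (\int[mu]_y ((v - Y y) ^+ 2 * w y))%:E)%E.
  rewrite /Rintegral fineK//.
  exact: (integrable_fin_num measurableT (integrable_sqr_dev v)).
by rewrite !intE (Rintegral_sqr_dev_mean _ mE).
Qed.

End scalar.

(** The squared Euclidean norm is a sum over coordinates, so the scalar splitting is applied to each
    coordinate and summed. *)
Lemma integral_sqnorm2_dev_mean n (Y : T -> 'rV[R]_n) (m u : 'rV[R]_n) :
  (forall i, mu.-integrable setT (EFin \o (fun y => Y y 0 i * w y))) ->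
  (forall i, mu.-integrable setT (EFin \o (fun y => Y y 0 i ^+ 2 * w y))) ->
  (forall i, m 0 i * \int[mu]_y w y = \int[mu]_y (Y y 0 i * w y)) ->
  (\int[mu]_y (sqnorm2 (u - Y y) * w y)%:E =
   (sqnorm2 (u - m) * \int[mu]_y w y)%:E
   + \int[mu]_y (sqnorm2 (m - Y y) * w y)%:E)%E.
Proof.
move=> int_Y int_Y2 mE.
have intE v : (\int[mu]_y (sqnorm2 (v - Y y) * w y)%:E =
    \sum_(i < n) \int[mu]_y ((v 0 i - Y y 0 i) ^+ 2 * w y)%:E)%E.
  rewrite -integral_sum//; last by move=> i; exact: integrable_sqr_dev.
  apply: eq_integral => y _; rewrite /sqnorm2 mulr_suml sumEFin; congr EFin.
  by apply: eq_bigr => i _; rewrite !mxE.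
rewrite !intE /sqnorm2 mulr_suml -sumEFin -big_split/=.
apply: eq_bigr => i _; rewrite (@integral_sqr_dev_mean _ _ _ (m 0 i))// !mxE//.
Qed.

End weighted_variance.

(** * The Gaussian density: score and bounds uniform in the point and the mean *)

Section gauss.
Context {R : realType} {d : nat}.
Local Notation V := 'rV[R]_d.

Lemma sqnorm2_ge0 (v : V) : 0 <= sqnorm2 v.
Proof. by apply: sumr_ge0 => i _; rewrite sqr_ge0. Qed.

Lemma sqr_coord_le_sqnorm2 (v : V) i : v 0 i ^+ 2 <= sqnorm2 v.
Proof.
by rewrite /sqnorm2 (bigD1 i)//= lerDl; apply: sumr_ge0 => j _; rewrite sqr_ge0.
Qed.

Lemma sqnorm2D_delta (v : V) i (h : R) :
  sqnorm2 (h *: delta_mx 0 i + v) = sqnorm2 v + 2 * h * v 0 i + h ^+ 2.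
Proof.
rewrite /sqnorm2 (bigD1 i)//= [in RHS](bigD1 i)//= !mxE !eqxx/=.
rewrite (eq_bigr (fun j => v 0 j ^+ 2)); first by ring.
by move=> j ji; rewrite !mxE (negbTE ji) andbF mulr0 add0r.
Qed.

(** Reduces to one real variable, where the chain rule and differentiation under the integral sign
    are available. *)
Lemma derive_line (f : V -> R) (x v : V) :
  'D_v f x = derive1 (fun h : R => f (h *: v + x)) 0.
Proof.
rewrite /derive /derive1.
rewrite [X in lim (X @ _) = _](_ : _ = fun h : R =>
  h^-1 *: (f ((h + 0) *: v + x) - f (0 *: v + x))) //.
by apply/funext => h /=; rewrite addr0 scale0r add0r.
Qed.

(** The logarithmic derivative [p' / p] along the [i]-th coordinate line, serving both the Gaussian
    and the mixture. *)
Lemma score_line (p : V -> R) (x : V) (i : 'I_d) (D : R) : 0 < p x ->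
  is_derive (0 : R) (1 : R) (fun h : R => p (h *: delta_mx 0 i + x)) D ->
  score p x 0 i = D / p x.
Proof.
move=> px0 dp; rewrite /score /grad mxE derive_line.
rewrite derive1E mulrC.
have -> : p x = p (0 *: delta_mx 0 i + x) by rewrite scale0r add0r.
apply: derive_val; apply: is_derive1_comp.
by apply: is_derive1_ln; rewrite scale0r add0r.
Qed.

Lemma gauss_pdf_gt0 (m : V) (v : R) x : 0 < v -> 0 < gauss_pdf m v x.
Proof.
move=> v0; rewrite /gauss_pdf mulr_gt0 ?expR_gt0// exprn_gt0// invr_gt0 sqrtr_gt0.
by rewrite !mulr_gt0// pi_gt0.
Qed.

Lemma gauss_pdf_ge0 (m : V) (v : R) x : 0 <= gauss_pdf m v x.
Proof. by rewrite mulr_ge0 ?expR_ge0// exprn_ge0// invr_ge0 sqrtr_ge0. Qed.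

Lemma is_derive_gauss_pdf (m : V) (v : R) x (i : 'I_d) (h : R) : 0 < v ->
  is_derive h (1 : R) (fun h : R => gauss_pdf m v (h *: delta_mx 0 i + x))
    (- ((h *: delta_mx 0 i + x - m) 0 i / v)
       * gauss_pdf m v (h *: delta_mx 0 i + x)).
Proof.
move=> v0; rewrite /gauss_pdf; set c := _ ^+ d.
under eq_fun do rewrite -addrA sqnorm2D_delta.
rewrite -addrA sqnorm2D_delta.
set A := sqnorm2 _; set b : R := (x - m) 0 i.
have -> : (h *: delta_mx 0 i + (x - m)) 0 i = h + b.
  by rewrite !mxE !eqxx mulr1 /b !mxE.
apply: is_derive_eq.
by rewrite /GRing.scale/=; field; rewrite gt_eqF.
Qed.


Lemma score_gauss_pdf (m : V) (v : R) x : 0 < v ->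
  score (gauss_pdf m v) x = - v^-1 *: (x - m).
Proof.
move=> v0; apply/rowP => i; have p0 := gauss_pdf_gt0 m x v0.
rewrite (score_line p0 (is_derive_gauss_pdf m x i 0 v0)) scale0r add0r.
by rewrite mulfK ?gt_eqF// !mxE mulNr mulrC.
Qed.

(* [u exp(-u) <= 1] at [u = |x - m|^2 / (2 v)]. *)
Lemma sqnorm2_gauss_pdf_le (m : V) (v : R) x : 0 < v ->
  sqnorm2 (x - m) * gauss_pdf m v x <=
  2 * v * (Num.sqrt (2 * pi * v))^-1 ^+ d.
Proof.
move=> v0; rewrite /gauss_pdf; set c := _ ^+ d; set u := _ / _.
have -> : sqnorm2 (x - m) = 2 * v * u by rewrite /u; field; rewrite gt_eqF.
rewrite mulrCA (mulrC _ c) ler_wpM2l//.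
  by rewrite exprn_ge0// invr_ge0 sqrtr_ge0.
rewrite -[leLHS]mulrA ler_piMr//; first by rewrite mulr_ge0// ltW.
rewrite expRN ler_pdivrMr ?expR_gt0// mul1r.
by rewrite (le_trans _ (expR_ge1Dx _))// lerDr.
Qed.

Lemma gauss_pdf_le (m : V) (v : R) x : 0 < v ->
  gauss_pdf m v x <= (Num.sqrt (2 * pi * v))^-1 ^+ d.
Proof.
move=> v0; rewrite /gauss_pdf; apply: ler_piMr.
  by rewrite exprn_ge0// invr_ge0 sqrtr_ge0.
rewrite expRN invf_le1 ?expR_gt0// (le_trans _ (expR_ge1Dx _))// lerDl.
by rewrite divr_ge0 ?sqnorm2_ge0// mulr_ge0// ltW.
Qed.

(** Since [z <= 1 + z^2], the two preceding bounds add up to this one. Being free of [x] and [m], it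
    later provides the domination for differentiating the mixture. *)
Lemma coord_gauss_pdf_le (m : V) (v : R) x i : 0 < v ->
  `|(x - m) 0 i| * gauss_pdf m v x <=
  (1 + 2 * v) * (Num.sqrt (2 * pi * v))^-1 ^+ d.
Proof.
move=> v0; rewrite [leRHS]mulrDl mul1r.
apply: le_trans (lerD (gauss_pdf_le m x v0) (sqnorm2_gauss_pdf_le m x v0)).
rewrite -{2}[gauss_pdf m v x]mul1r -mulrDl ler_wpM2r ?gauss_pdf_ge0//.
have := sqr_coord_le_sqnorm2 (x - m) i; rewrite -real_normK ?num_real//.
by set z := `|_|; nra.
Qed.

End gauss.

(** * Measurability of vector operations and of the Gaussian density in all its arguments *)

Section measurability.
Context {R : realType}.

(** Inversion is continuous off 0, and the point 0, where it takes the value 0, is a measurable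
    singleton treated apart. *)
Lemma measurable_inv : measurable_fun [set: R] (@GRing.inv R).
Proof.
have -> : [set: R] = [set 0] `|` ~` [set 0] by rewrite setUv.
apply/measurable_funU => //; first exact: measurableC.
split; first exact: measurable_fun_set1.
apply: open_continuous_measurable_fun.
  by apply: closed_openC; exact: accessible_closed_set1 (hausdorff_accessible (@Rhausdorff R)) 0.
by move=> x /set_mem/eqP x0; exact: inv_continuous.
Qed.

Context {d : nat} d' (T : measurableType d').
Implicit Types f g : T -> 'rV[R]_d.

Lemma measurable_coord f i : measurable_fun setT f ->
  measurable_fun setT (fun z => f z 0 i).
Proof. by move=> mf; exact: (measurableT_comp (measurable_rV_coord i) mf). Qed.

Lemma measurable_rVB f g : measurable_fun setT f -> measurable_fun setT g ->
  measurable_fun setT (fun z => f z - g z).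
Proof.
move=> mf mg; apply: measurable_fun_rV => i.
have := measurable_funB (measurable_coord i mf) (measurable_coord i mg).
by apply: eq_measurable_fun => z _; rewrite /= /rV_coord !mxE.
Qed.

Lemma measurable_rVZ (c : T -> R) f : measurable_fun setT c ->
  measurable_fun setT f -> measurable_fun setT (fun z => c z *: f z).
Proof.
move=> mc mf; apply: measurable_fun_rV => i.
have := measurable_funM mc (measurable_coord i mf).
by apply: eq_measurable_fun => z _; rewrite /= /rV_coord !mxE.
Qed.

Lemma measurable_sqnorm2 f : measurable_fun setT f ->
  measurable_fun setT (fun z => sqnorm2 (f z)).
Proof.
by move=> mf; apply: measurable_sum => i; apply/measurable_funX/measurable_coord.
Qed.

Lemma measurable_gauss_pdf f (v : T -> R) g : measurable_fun setT f ->
  measurable_fun setT v -> measurable_fun setT g ->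
  measurable_fun setT (fun z => gauss_pdf (f z) (v z) (g z)).
Proof.
move=> mf mv mg; apply: measurable_funM.
  apply: measurable_funX; apply: (measurableT_comp measurable_inv).
  have msqrt := continuous_measurable_fun (@sqrt_continuous R).
  by apply: (measurableT_comp msqrt); exact: measurable_funM.
apply: (@measurableT_comp _ _ _ _ _ _ expR) => //.
apply: measurableT_comp => //.
apply: measurable_funM; first exact/measurable_sqnorm2/measurable_rVB.
by apply: (measurableT_comp measurable_inv); exact: measurable_funM.
Qed.

End measurability.

(** * Gaussian mixtures with mixing density [p1], and their score *)

Section mixture.
Context {R : realType} {d : nat}.
Local Notation V := 'rV[R]_d.
Local Notation leb := (@lebesgue_rV R d).
Variable p1 : V -> R.
Hypothesis h_p1 : is_density p1.

Let mp1 : measurable_fun setT p1. Proof. by case: h_p1. Qed.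
Let p1_ge0 x : 0 <= p1 x. Proof. by case: h_p1. Qed.

Lemma integrable_density : leb.-integrable setT (EFin \o p1).
Proof.
apply/integrableP; split; first exact/measurable_EFinP.
under eq_integral do rewrite /= ger0_norm//.
by case: h_p1 => _ _ ->; rewrite ltry.
Qed.

Lemma integrable_mul_density (g : V -> R) (M : R) : measurable_fun setT g ->
  (forall y, `|g y| <= M) -> leb.-integrable setT (EFin \o (fun y => g y * p1 y)).
Proof.
move=> mg gM; apply: (@le_integrable _ _ _ _ _ measurableT _
    (EFin \o (fun y => M * p1 y))).
- by apply/measurable_EFinP; exact: measurable_funM.
- move=> y _; rewrite /= lee_fin !normrM ler_wpM2r//.
  by rewrite (le_trans (gM y))// ler_norm.
- by have := integrableZl measurableT M integrable_density.
Qed.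

Section scale.
Variables a v : R.
Hypothesis v0 : 0 < v.

(** The marginal density at one time, with [a] for [alpha t] and [v] for the variance
    [sigma t ^+ 2]. *)
Definition mixture (x : V) : R := \int[leb]_y (gauss_pdf (a *: y) v x * p1 y).

Let sc (x y : V) : V := - v^-1 *: (x - a *: y).

Let c := (Num.sqrt (2 * pi * v))^-1 ^+ d.

Let mid : measurable_fun setT (@id V). Proof. exact: measurable_id. Qed.

Let mK x : measurable_fun setT (fun y : V => gauss_pdf (a *: y) v x).
Proof. by apply: measurable_gauss_pdf => //; exact: measurable_rVZ. Qed.

Let msc x : measurable_fun setT (sc x).
Proof. by apply: measurable_rVZ => //; apply/measurable_rVB/measurable_rVZ. Qed.

Lemma integrable_mixture (x : V) :
  leb.-integrable setT (EFin \o (fun y : V => gauss_pdf (a *: y) v x * p1 y)).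
Proof.
apply: (@integrable_mul_density _ c) => // y.
by rewrite ger0_norm ?gauss_pdf_ge0//; exact: gauss_pdf_le.
Qed.

Let sc_le x y i : `|sc x y 0 i * gauss_pdf (a *: y) v x| <= v^-1 * ((1 + 2 * v) * c).
Proof.
rewrite /sc mxE -mulrA normrM normrN (gtr0_norm (_ : 0 < v^-1)) ?invr_gt0//.
rewrite ler_pM2l ?invr_gt0//.
by rewrite normrM (ger0_norm (gauss_pdf_ge0 _ _ _)); exact: coord_gauss_pdf_le.
Qed.

Lemma integrable_score_mixture (x : V) (i : 'I_d) : leb.-integrable setT
  (EFin \o (fun y : V => (- v^-1 *: (x - a *: y)) 0 i *
                     (gauss_pdf (a *: y) v x * p1 y))).
Proof.
under eq_fun do rewrite mulrA.
apply: (@integrable_mul_density _ (v^-1 * ((1 + 2 * v) * c))).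
- by apply: measurable_funM => //; exact: measurable_coord (msc x).
- by move=> y; exact: sc_le.
Qed.

Lemma integrable_score2_mixture (x : V) (i : 'I_d) : leb.-integrable setT
  (EFin \o (fun y : V => (- v^-1 *: (x - a *: y)) 0 i ^+ 2 *
                     (gauss_pdf (a *: y) v x * p1 y))).
Proof.
under eq_fun do rewrite mulrA.
apply: (@integrable_mul_density _ (v^-1 ^+ 2 * (2 * v * c))).
- apply: measurable_funM => //; apply: measurable_funX.
  exact: measurable_coord (msc x).
- move=> y; rewrite mxE exprMn sqrrN ger0_norm; last first.
    by rewrite -exprMn mulr_ge0 ?sqr_ge0 ?gauss_pdf_ge0.
  rewrite -[leLHS]mulrA ler_wpM2l ?sqr_ge0//.
  apply: le_trans (sqnorm2_gauss_pdf_le (a *: y) x v0).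
  by rewrite ler_wpM2r ?gauss_pdf_ge0// sqr_coord_le_sqnorm2.
Qed.

(** The kernel is strictly positive, so a zero integral would force [p1 = 0] almost everywhere,
    against its total mass 1. Positivity makes the logarithm differentiable and allows division by
    the mixture. *)
Lemma mixture_gt0 x : 0 < mixture x.
Proof.
have w0 (y : V) : 0 <= gauss_pdf (a *: y) v x * p1 y.
  by rewrite mulr_ge0 ?gauss_pdf_ge0.
rewrite lt_neqAle Rintegral_ge0 ?andbT; last by move=> y _; exact: w0.
apply/eqP => W0.
(* A real integral is [fine] of an extended one and is also 0 when the latter is infinite;
   finiteness rules this out. *)
have fW := integrable_fin_num measurableT (integrable_mixture x).
have : (\int[leb]_y `|(gauss_pdf (a *: y) v x * p1 y)%:E| = 0)%E.
  under eq_integral do rewrite /= ger0_norm//.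
  by rewrite -[RHS]/(0%:E) W0 /mixture /Rintegral fineK.
have mw : measurable_fun setT (fun y : V => (gauss_pdf (a *: y) v x * p1 y)%:E).
  by apply/measurable_EFinP; exact: measurable_funM.
move=> /(ae_eq_integral_abs leb measurableT mw) w_ae0.
have : (\int[leb]_y (p1 y)%:E = \int[leb]_y (cst 0 y))%E.
  apply: ae_eq_integral => //; first exact/measurable_EFinP.
  apply: filterS w_ae0 => y /(_ I)[] /eqP; rewrite mulf_eq0.
  by rewrite gt_eqF ?gauss_pdf_gt0//= => /eqP -> _.
rewrite integral_cst// mul0e; case: h_p1 => _ _ ->.
by move=> [] /eqP; rewrite oner_eq0.
Qed.

(** The derivative of the kernel is the conditional score times the kernel; differentiating under
    the integral along a coordinate line then gives the gradient of the mixture, which is score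
    times mixture. *)
Lemma score_mixture (x : V) (i : 'I_d) : score mixture x 0 i * mixture x =
  \int[leb]_y ((- v^-1 *: (x - a *: y)) 0 i * (gauss_pdf (a *: y) v x * p1 y)).
Proof.
pose f (h : R) (y : V) := gauss_pdf (a *: y) v (h *: delta_mx 0 i + x) * p1 y.
have df h y : is_derive h (1 : R) (f ^~ y)
    (sc (h *: delta_mx 0 i + x) y 0 i
     * gauss_pdf (a *: y) v (h *: delta_mx 0 i + x) * p1 y).
  have h1 := is_derive_gauss_pdf (a *: y) x i h v0.
  rewrite /f; apply: is_derive_eq; rewrite /GRing.scale/= mulr0 add0r mulrC.
  by congr (_ * _ * _); rewrite /sc [RHS]mxE mulNr mulrC.
(* The dominating function: the uniform bound [sc_le] on score times kernel, multiplied by [p1]. It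
   does not depend on [h], so the interval []-1, 1[] around 0 is an arbitrary choice. *)
pose G y := v^-1 * ((1 + 2 * v) * c) * p1 y.
have I0 : `]-1, 1[%classic (0 : R) by rewrite /= in_itv/= ltrN10 ltr01.
have intf h : `]-1, 1[%classic h -> leb.-integrable setT (EFin \o f h).
  by move=> _; exact: integrable_mixture.
have derf h y : `]-1, 1[%classic h -> [set: V] y -> derivable (f ^~ y) h 1.
  by move=> _ _; case: (df h y).
have c0 : 0 <= c by rewrite exprn_ge0// invr_ge0 sqrtr_ge0.
have G0 y : 0 <= G y.
  by rewrite /G !mulr_ge0// ?invr_ge0 ?(ltW v0)// addr_ge0// mulr_ge0// ltW.
have intG : leb.-integrable setT (EFin \o G).
  have := integrableZl measurableT (v^-1 * ((1 + 2 * v) * c)) integrable_density.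
  by [].
have partialE h y : partial1of2 f h y = sc (h *: delta_mx 0 i + x) y 0 i
     * gauss_pdf (a *: y) v (h *: delta_mx 0 i + x) * p1 y.
  by rewrite partial1of2E; exact: derive_val.
have Gub h y : `]-1, 1[%classic h -> [set: V] y -> `|partial1of2 f h y| <= G y.
  by move=> _ _; rewrite partialE normrM (ger0_norm (p1_ge0 y)) ler_wpM2r//.
have dF := differentiation_under_integral measurableT I0 intf derf G0 intG Gub.
have DF := derivable_under_integral measurableT I0 intf derf G0 intG Gub.
have dW : is_derive (0 : R) (1 : R)
    (fun h : R => mixture (h *: delta_mx 0 i + x))
    (\int[leb]_y (sc x y 0 i * (gauss_pdf (a *: y) v x * p1 y))).
  apply: DeriveDef => //; rewrite -derive1E dF.
  by apply: eq_Rintegral => y _; rewrite partialE scale0r add0r mulrA.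
by rewrite (score_line (mixture_gt0 x) dW) divfK// gt_eqF// mixture_gt0.
Qed.

Lemma integral_sqnorm2_sub_score x (u : V) :
  (\int[leb]_y (sqnorm2 (u - - v^-1 *: (x - a *: y))
                * (gauss_pdf (a *: y) v x * p1 y))%:E =
   (sqnorm2 (u - score mixture x) * mixture x)%:E
   + \int[leb]_y (sqnorm2 (score mixture x - - v^-1 *: (x - a *: y))
                  * (gauss_pdf (a *: y) v x * p1 y))%:E)%E.
Proof.
apply: integral_sqnorm2_dev_mean.
- exact: integrable_mixture.
- exact: integrable_score_mixture.
- exact: integrable_score2_mixture.
- exact: score_mixture.
Qed.

End scale.
End mixture.

(** Tonelli's theorem is applied to the positive and negative parts separately, and [fine] is
    measurable. *)
Lemma measurable_fun_Rintegral d1 d2 (T1 : measurableType d1)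
    (T2 : measurableType d2) (R : realType)
    (m2 : {sigma_finite_measure set T2 -> \bar R}) (f : T1 * T2 -> R) :
  measurable_fun setT f ->
  measurable_fun setT (fun x => \int[m2]_y f (x, y)).
Proof.
move=> mf; apply: measurableT_comp => //.
under eq_fun do rewrite integralE.
have mEf : measurable_fun setT (EFin \o f) by exact/measurable_EFinP.
apply: emeasurable_funB.
- apply: eq_measurable_fun (measurable_fun_fubini_tonelli_F _
    (measurable_funepos mEf) (funepos_ge0 (EFin \o f))) => x _.
  by apply: eq_integral => y _; rewrite !funeposE.
- apply: eq_measurable_fun (measurable_fun_fubini_tonelli_F _
    (measurable_funeneg mEf) (funeneg_ge0 (EFin \o f))) => x _.
  by apply: eq_integral => y _; rewrite !funenegE.
Qed.

(* Here the square root is 0 and its inverse, by convention, also 0; only the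
   0th power in dimension 0 escapes. *)
Lemma gauss_pdf_degenerate (R : realType) d (v : R) : v <= 0 ->
  (forall u : 'rV[R]_d, sqnorm2 u = 0) \/
  (forall m x : 'rV[R]_d, gauss_pdf m v x = 0).
Proof.
move=> v0; case: d => [|d]; [left => u|right => m x].
  by rewrite /sqnorm2 big_ord0.
have -> : gauss_pdf m v x = (Num.sqrt (2 * pi * v))^-1 ^+ d.+1 *
  expR (- (sqnorm2 (x - m) / (2 * v))) by [].
by rewrite ler0_sqrtr ?invr0 ?exprS ?mul0r// mulr_ge0_le0// mulr_ge0// pi_ge0.
Qed.

(** * The decomposition at a fixed time *)

Section fixed_time.
Context {R : realType} {d : nat}.
Local Notation V := 'rV[R]_d.
Local Notation leb := (@lebesgue_rV R d).
Variables (p1 : V -> R) (h_p1 : is_density p1) (a v : R).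

Let p1_ge0 x : 0 <= p1 x. Proof. by case: h_p1. Qed.
Let mp1 : measurable_fun setT p1. Proof. by case: h_p1. Qed.

Definition SM_at (u : V -> V) : \bar R :=
  expect (mixture p1 a v)
    (fun x => (sqnorm2 (u x - score (mixture p1 a v) x))%:E).

Definition CSM_at (u : V -> V) : \bar R :=
  expect p1 (fun x1 => expect (gauss_pdf (a *: x1) v)
    (fun x => (sqnorm2 (u x - score (gauss_pdf (a *: x1) v) x))%:E)).

(** The posterior mean of the conditional score. It equals the marginal score when [v > 0], but as a
    quotient of integrals it is measurable by Tonelli, with no limit of difference quotients to
    handle. *)
Definition post_score (x : V) : V :=
  \row_i ((\int[leb]_y ((- v^-1 *: (x - a *: y)) 0 i *
                        (gauss_pdf (a *: y) v x * p1 y))) / mixture p1 a v x).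

(** The contribution of one time to the constant: for [v > 0], the weighted variance of the
    conditional scores, integrated over [x]. *)
Definition gap_at : \bar R :=
  (\int[leb]_x \int[leb]_y (sqnorm2 (post_score x - - v^-1 *: (x - a *: y))
                             * (gauss_pdf (a *: y) v x * p1 y))%:E)%E.

Lemma gap_at_ge0 : (0 <= gap_at)%E.
Proof.
apply: integral_ge0 => x _; apply: integral_ge0 => y _.
by rewrite lee_fin !mulr_ge0 ?sqnorm2_ge0 ?gauss_pdf_ge0.
Qed.

Lemma post_scoreE x : 0 < v -> post_score x = score (mixture p1 a v) x.
Proof.
move=> v0; apply/rowP => i.
by rewrite mxE -(score_mixture h_p1 a v0) mulfK// gt_eqF// mixture_gt0.
Qed.

(** For [v > 0] the two scores coincide; for [v <= 0] both integrands vanish, through the norm in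
    dimension 0 and through the density otherwise. *)
Lemma SM_atE u :
  SM_at u = (\int[leb]_x (sqnorm2 (u x - post_score x) * mixture p1 a v x)%:E)%E.
Proof.
rewrite /SM_at /expect; apply: eq_integral => x _; rewrite -EFinM.
have [v0|v0] := leP v 0; last by rewrite post_scoreE.
congr EFin; case: (@gauss_pdf_degenerate R d v v0) => h0; first by rewrite !h0.
by rewrite /mixture; under eq_Rintegral do rewrite h0 mul0r;
  rewrite Rintegral_cst// mul0r !mulr0.
Qed.

Lemma CSM_atE u : measurable_fun setT u -> measurable_fun setT post_score ->
  measurable_fun setT (mixture p1 a v) ->
  CSM_at u = (SM_at u + gap_at)%E.
Proof.
move=> mu mpost mmix.
have mc : measurable_fun setT (fun z : V * V => z.1 - a *: z.2).
  by apply/measurable_rVB/measurable_rVZ.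
have msc : measurable_fun setT (fun z : V * V => - v^-1 *: (z.1 - a *: z.2)).
  exact: measurable_rVZ.
have mw : measurable_fun setT
    (fun z : V * V => gauss_pdf (a *: z.2) v z.1 * p1 z.2).
  apply: measurable_funM; last exact: measurableT_comp.
  by apply: measurable_gauss_pdf => //; exact: measurable_rVZ.
have mdev (g : V -> V) : measurable_fun setT g -> measurable_fun setT (fun z : V * V =>
    (sqnorm2 (g z.1 - - v^-1 *: (z.1 - a *: z.2))
     * (gauss_pdf (a *: z.2) v z.1 * p1 z.2))%:E).
  move=> mg; apply/measurable_EFinP/measurable_funM => //.
  apply/measurable_sqnorm2/measurable_rVB => //.
  exact: (measurableT_comp mg measurable_fst).
have dev_ge0 (g : V -> V) (z : V * V) : (0 <= (sqnorm2 (g z.1 - - v^-1 *: (z.1 - a *: z.2))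
     * (gauss_pdf (a *: z.2) v z.1 * p1 z.2))%:E)%E.
  by rewrite lee_fin !mulr_ge0 ?sqnorm2_ge0 ?gauss_pdf_ge0.
(* The conditional score is made explicit and the factor [p1 y] moved inside, giving a nonnegative
   double integral ready for exchange. *)
have -> : CSM_at u = (\int[leb]_y \int[leb]_x
    (sqnorm2 (u x - - v^-1 *: (x - a *: y))
     * (gauss_pdf (a *: y) v x * p1 y))%:E)%E.
  rewrite /CSM_at /expect; apply: eq_integral => y _.
  rewrite (_ : integral _ _ _ = (\int[leb]_x
      (sqnorm2 (u x - - v^-1 *: (x - a *: y)) * gauss_pdf (a *: y) v x)%:E)%E).
    rewrite -ge0_integralZr//=.
    - by apply: eq_integral => x _; rewrite -EFinM mulrA.
    - apply/measurable_EFinP/measurable_funM; last exact: measurable_gauss_pdf.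
      by apply/measurable_sqnorm2/measurable_rVB/measurable_rVZ/measurable_rVB.
    - by move=> x _; rewrite lee_fin mulr_ge0 ?sqnorm2_ge0 ?gauss_pdf_ge0.
    - by rewrite lee_fin.
  apply: eq_integral => x _; rewrite -EFinM; congr EFin.
  have [v0|v0] := leP v 0; last by rewrite score_gauss_pdf.
  by case: (@gauss_pdf_degenerate R d v v0) => h0; rewrite !h0 ?mul0r ?mulr0.
(* After the exchange, [x] is the outer variable and the splitting applies pointwise in [x]. *)
have /= <- := fubini_tonelli _ (mdev u mu) (dev_ge0 u).
rewrite SM_atE /gap_at -ge0_integralD//=; last 4 first.
- by move=> x _; rewrite lee_fin mulr_ge0 ?sqnorm2_ge0// Rintegral_ge0// => y _;
    rewrite mulr_ge0 ?gauss_pdf_ge0.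
- apply/measurable_EFinP/measurable_funM => //.
  by apply/measurable_sqnorm2/measurable_rVB.
- by move=> x _; apply: integral_ge0 => y _; exact: (dev_ge0 _ (x, y)).
- exact: (measurable_fun_fubini_tonelli_F _ (mdev _ mpost) (dev_ge0 _)).
apply: eq_integral => x _.
have [v0|v0] := leP v 0; last by rewrite post_scoreE// integral_sqnorm2_sub_score.
case: (@gauss_pdf_degenerate R d v v0) => h0.
  by rewrite h0 mul0r add0e; apply: eq_integral => y _; rewrite !h0.
rewrite (_ : mixture p1 a v x = 0) ?mulr0 ?add0e.
  by apply: eq_integral => y _; rewrite h0 mul0r !mulr0.
by rewrite /mixture; under eq_Rintegral do rewrite h0 mul0r;
  rewrite Rintegral_cst// mul0r.
Qed.

End fixed_time.

(** * Joint measurability in space and time *)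

Section joint_measurability.
Context {R : realType} {d : nat}.
Local Notation V := 'rV[R]_d.
Local Notation leb := (@lebesgue_rV R d).
Variables (p1 : V -> R) (h_p1 : is_density p1) (a v : R -> R).
Hypothesis (ma : measurable_fun setT a) (mv : measurable_fun setT v).

Let p1_ge0 x : 0 <= p1 x. Proof. by case: h_p1. Qed.
Let mp1 : measurable_fun setT p1. Proof. by case: h_p1. Qed.

Let Z := ((V * R) * V)%type.

Let mx : measurable_fun setT (fun z : Z => z.1.1).
Proof. exact: (measurableT_comp measurable_fst measurable_fst). Qed.

Let mt (f : R -> R) : measurable_fun setT f ->
  measurable_fun setT (fun z : Z => f z.1.2).
Proof.
by move=> mf; apply: (measurableT_comp mf);
  exact: (measurableT_comp measurable_snd measurable_fst).
Qed.

Let mmean : measurable_fun setT (fun z : Z => a z.1.2 *: z.2).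
Proof. by apply: measurable_rVZ => //; exact: mt. Qed.

Let mweight : measurable_fun setT
  (fun z : Z => gauss_pdf (a z.1.2 *: z.2) (v z.1.2) z.1.1 * p1 z.2).
Proof.
apply: measurable_funM; last exact: (measurableT_comp mp1 measurable_snd).
by apply: measurable_gauss_pdf => //; exact: mt.
Qed.

Let mscore : measurable_fun setT
  (fun z : Z => - (v z.1.2)^-1 *: (z.1.1 - a z.1.2 *: z.2)).
Proof.
apply: measurable_rVZ; last exact: measurable_rVB.
by apply: measurableT_comp => //; apply: (measurableT_comp measurable_inv); exact: mt.
Qed.

Lemma measurable_mixture :
  measurable_fun setT (fun xt : V * R => mixture p1 (a xt.2) (v xt.2) xt.1).
Proof. exact: (measurable_fun_Rintegral leb mweight). Qed.

Lemma measurable_post_score :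
  measurable_fun setT (fun xt : V * R => post_score p1 (a xt.2) (v xt.2) xt.1).
Proof.
apply: measurable_fun_rV => i.
have mi := measurable_funM (measurable_fun_Rintegral leb
  (measurable_funM (measurable_coord i mscore) mweight))
  (measurableT_comp measurable_inv measurable_mixture).
by apply: eq_measurable_fun mi => xt _; rewrite /rV_coord /= mxE.
Qed.

Lemma measurable_SM_at (u : V * R -> V) : measurable_fun setT u ->
  measurable_fun setT (fun t => SM_at p1 (a t) (v t) (fun x => u (x, t))).
Proof.
move=> mu; under eq_fun do rewrite SM_atE//.
apply: (measurable_fun_fubini_tonelli_G (m1 := leb) (fun xt : V * R =>
  (sqnorm2 (u xt - post_score p1 (a xt.2) (v xt.2) xt.1)
   * mixture p1 (a xt.2) (v xt.2) xt.1)%:E)).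
- apply/measurable_EFinP/measurable_funM; last exact: measurable_mixture.
  by apply/measurable_sqnorm2/measurable_rVB => //; exact: measurable_post_score.
- move=> xt; rewrite lee_fin mulr_ge0 ?sqnorm2_ge0// Rintegral_ge0// => y _.
  by rewrite mulr_ge0 ?gauss_pdf_ge0.
Qed.

Lemma measurable_gap_at : measurable_fun setT (fun t => gap_at p1 (a t) (v t)).
Proof.
pose f (z : Z) := (sqnorm2 (post_score p1 (a z.1.2) (v z.1.2) z.1.1
    - - (v z.1.2)^-1 *: (z.1.1 - a z.1.2 *: z.2))
  * (gauss_pdf (a z.1.2 *: z.2) (v z.1.2) z.1.1 * p1 z.2))%:E.
have mf : measurable_fun setT f.
  apply/measurable_EFinP/measurable_funM => //.
  apply/measurable_sqnorm2/measurable_rVB => //.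
  exact: (measurableT_comp measurable_post_score measurable_fst).
have f0 z : (0 <= f z)%E.
  by rewrite lee_fin !mulr_ge0 ?sqnorm2_ge0 ?gauss_pdf_ge0.
(* The data point is integrated out first, then [x], leaving a function of time. *)
apply: (measurable_fun_fubini_tonelli_G (m1 := leb) (fubini_F leb f)).
- exact: measurable_fun_fubini_tonelli_F.
- by move=> xt; apply: integral_ge0 => y _; exact: f0.
Qed.

End joint_measurability.

(** The measurability in [x] required by [CSM_atE] is read off the joint statements for constant
    schedules, along the slice [x |-> (x, 0)]. *)
Lemma CSM_at_decomposition (R : realType) d (p1 : 'rV[R]_d -> R)
    (h_p1 : is_density p1) (a v : R) (u : 'rV[R]_d -> 'rV[R]_d) :
  measurable_fun setT u -> CSM_at p1 a v u = (SM_at p1 a v u + gap_at p1 a v)%E.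
Proof.
have m0 : measurable_fun setT (fun x : 'rV[R]_d => (x, 0 : R)).
  exact: measurable_fun_pair.
move=> mu; apply: CSM_atE => //.
- exact: (measurableT_comp (measurable_post_score h_p1 (a := cst a) (v := cst v)
    (@measurable_cst _ _ _ _ _ _) (@measurable_cst _ _ _ _ _ _)) m0).
- exact: (measurableT_comp (measurable_mixture h_p1 (a := cst a) (v := cst v)
    (@measurable_cst _ _ _ _ _ _) (@measurable_cst _ _ _ _ _ _)) m0).
Qed.

(** Derivability gives continuity on the open interval, and adding the endpoints does not affect
    measurability. *)
Lemma measurable_derivable_itv (R : realType) (f : R -> R) (x y : R) :
  {in `]x, y[, forall t, derivable f t 1} -> measurable_fun `[x, y] f.
Proof.
move=> df; apply/(measurable_fun_itv_bndo_bndcP (BLeft x) y f).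
apply/(measurable_fun_itv_obnd_cbndP x (BLeft y) f).
apply: open_continuous_measurable_fun; first exact: interval_open.
move=> t /set_mem/df dft; apply: differentiable_continuous.
exact/derivable1_diffP.
Qed.

(** * Integration over time and the constant *)

Section losses.
Context {R : realType} {d : nat}.
Variables (lambda alpha sigma : R -> R) (p1 : 'rV[R]_d -> R).

Lemma SM_lossE s : SM_loss lambda alpha sigma p1 s =
  ((2^-1)%:E * \int[lebesgue_measure]_(t in `[0%R, 1%R])
    ((lambda t)%:E * SM_at p1 (alpha t) (sigma t ^+ 2) (s ^~ t)))%E.
Proof. by []. Qed.

Lemma CSM_lossE s : CSM_loss lambda alpha sigma p1 s =
  ((2^-1)%:E * \int[lebesgue_measure]_(t in `[0%R, 1%R])
    ((lambda t)%:E * CSM_at p1 (alpha t) (sigma t ^+ 2) (s ^~ t)))%E.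
Proof. by []. Qed.

End losses.

Unset Implicit Arguments.
Set Strict Implicit.

Theorem theorem8p6 (R : realType) (d : nat) (alpha sigma : R -> R)
    (h_schedule : schedule alpha sigma)
    (p1 : 'rV[R]_d -> R) (h_p1 : is_density p1)
    (lambda : R -> R)
    (h_lambda_meas : measurable_fun (`[0, 1]%classic : set R) lambda)
    (h_lambda_ge0 : forall t, t \in `[0, 1] -> 0 <= lambda t)
    (Theta : Type) (s : Theta -> 'rV[R]_d -> R -> 'rV[R]_d)
    (h_s_meas : forall theta,
       measurable_fun ([set: 'rV[R]_d] `*` (`[0, 1]%classic : set R))
         (fun xt : 'rV[R]_d * R => s theta xt.1 xt.2)) :
  exists C : \bar R,
    [/\ (0 <= C)%E,
        (exists theta, (CSM_loss lambda alpha sigma p1 (s theta) < +oo)%E) ->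
          C \is a fin_num
      & forall theta,
          CSM_loss lambda alpha sigma p1 (s theta) =
          (SM_loss lambda alpha sigma p1 (s theta) + C)%E].
Proof.
pose I : set R := `[0, 1]%classic.
have mI : measurable I by exact: measurable_itv.
(* Schedules and score model are extended by 0 outside the time interval, so that the joint
   measurability results, stated on the whole space, apply; nothing changes on [I]. *)
pose a := alpha \_ I; pose v := (fun t => sigma t ^+ 2) \_ I.
have [_ _ dsched _] := h_schedule.
have ma : measurable_fun setT a.
  rewrite /a; apply/(measurable_restrictT _ mI).
  by apply: measurable_derivable_itv => t /dsched[].
have mv : measurable_fun setT v.
  rewrite /v; apply/(measurable_restrictT _ mI).
  by apply: measurable_derivable_itv => t /dsched[].
have aE t : I t -> a t = alpha t by move=> It; rewrite /a patchE mem_set.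
have vE t : I t -> v t = sigma t ^+ 2 by move=> It; rewrite /v patchE mem_set.
pose u theta := (fun xt : 'rV[R]_d * R => s theta xt.1 xt.2) \_ (setT `*` I).
have mu theta : measurable_fun setT (u theta).
  rewrite /u; apply/(measurable_restrictT _ (measurableX measurableT mI)).
  exact: h_s_meas.
have uE theta t : I t -> (fun x => u theta (x, t)) = s theta ^~ t.
  by move=> It; apply/funext => x; rewrite /u patchE mem_set.
have mlam : measurable_fun I (EFin \o lambda) by exact/measurable_EFinP.
have lam0 t : I t -> (0 <= (lambda t)%:E)%E by move=> It; rewrite lee_fin h_lambda_ge0.
have SM0 theta t : (0 <= SM_at p1 (a t) (v t) (fun x => u theta (x, t)))%E.
  apply: integral_ge0 => x _; rewrite mule_ge0 ?lee_fin ?sqnorm2_ge0//.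
  apply: Rintegral_ge0 => y _; rewrite mulr_ge0 ?gauss_pdf_ge0//.
  by case: h_p1.
have SME theta : SM_loss lambda alpha sigma p1 (s theta) =
    (2^-1%:E * \int[lebesgue_measure]_(t in I)
      ((lambda t)%:E * SM_at p1 (a t) (v t) (fun x => u theta (x, t))))%E.
  rewrite SM_lossE; apply: f_equal; apply: eq_integral => t /set_mem It.
  by rewrite (uE _ _ It) (aE _ It) (vE _ It).
(* The witness contains neither [theta] nor [s]. *)
exists (2^-1%:E * \int[lebesgue_measure]_(t in I)
  ((lambda t)%:E * gap_at p1 (a t) (v t)))%E.
have half0 : (0 <= (2^-1 : R)%:E)%E by rewrite lee_fin invr_ge0.
have C0 : (0 <= 2^-1%:E * \int[lebesgue_measure]_(t in I)
    ((lambda t)%:E * gap_at p1 (a t) (v t)))%E.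
  rewrite mule_ge0//; apply: integral_ge0 => t It.
  by rewrite mule_ge0 ?gap_at_ge0// lam0.
have CSME theta : CSM_loss lambda alpha sigma p1 (s theta) =
    (SM_loss lambda alpha sigma p1 (s theta) + 2^-1%:E *
     \int[lebesgue_measure]_(t in I) ((lambda t)%:E * gap_at p1 (a t) (v t)))%E.
  (* In the extended reals, distributivity and additivity of the integral rest on nonnegativity of
     both terms. *)
  rewrite SME CSM_lossE -ge0_muleDr; first last.
  - by apply: integral_ge0 => t It; rewrite mule_ge0 ?gap_at_ge0// lam0.
  - by apply: integral_ge0 => t It; rewrite mule_ge0 ?lam0.
  rewrite -ge0_integralD//=; first last.
  - apply: emeasurable_funM => //; apply: measurable_funTS.
    exact: measurable_gap_at.
  - by move=> t It; rewrite mule_ge0 ?gap_at_ge0// lam0.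
  - apply: emeasurable_funM => //; apply: measurable_funTS.
    exact: measurable_SM_at.
  - by move=> t It; rewrite mule_ge0 ?lam0.
  apply: f_equal; apply: eq_integral => t /set_mem It.
  have mut : measurable_fun setT (fun x => u theta (x, t)).
    by apply: (measurableT_comp (mu theta)); exact: measurable_fun_pair.
  rewrite -ge0_muleDr; [|exact: SM0|exact: gap_at_ge0].
  rewrite -(CSM_at_decomposition h_p1 _ _ mut).
  by rewrite (uE _ _ It) (aE _ It) (vE _ It).
(* The marginal loss is nonnegative, so the constant is at most the conditional loss and is finite
   as soon as that loss is. *)
split => // -[theta]; rewrite CSME => CSM_fin.
rewrite ge0_fin_numE//; apply: le_lt_trans CSM_fin; apply: leeDr.
rewrite SME mule_ge0//; apply: integral_ge0 => t It.
by rewrite mule_ge0 ?lam0.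
Qed.
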